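(* Let $n\ge 1$. If there exists a totally skew disk $D^n\subset\mathbf{R}^N$, then the vector bundle $(N-n)\xi_{n-1}$ over $\mathbf{RP}^{n-1}$ admits $n+1$ linearly independent sections. Thus $$N(n)\ge r(n)+n,$$ where $r(n)$ is the smallest integer $r$ such that $r\xi_{n-1}$ admits $n+1$ linearly independent sections.
   Context: $\xi_p$ denotes the canonical (tautological) real line bundle over the real projective space $\mathbf{RP}^p$, and $r\xi_p$ is the Whitney sum of $r$ copies of $\xi_p$. Sections are continuous, and ''linearly independent'' means linearly independent at every point of the base. A pair of lines in $\mathbf{R}^N$ is skew if they are not parallel and do not intersect (in particular, two equal lines are not skew). A submanifold $M^n\subset\mathbf{R}^N$ (with $C^1$ regularity) is totally skew if every pair of (affine) tangent lines of $M$ is skew, unless they are tangent to $M$ at the same point. A totally skew disk $D^n\subset\mathbf{R}^N$ is a totally skew submanifold that is an embedded $n$-dimensional disk. A ($C^1$) embedding is totally skew if its image is totally skew. $N(n)$ denotes the smallest $N$ such that $\mathbf{R}^n$ admits a totally skew embedding in $\mathbf{R}^N$. *)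

(* Defs.v *)
From HB Require Import structures.
From mathcomp Require Import all_boot all_order all_algebra.
From mathcomp Require Import all_classical all_reals all_analysis.

Set Implicit Arguments.
Unset Strict Implicit.
Unset Printing Implicit Defensive.

Import Order.TTheory GRing.Theory Num.Theory.
Import numFieldNormedType.Exports.

Local Open Scope classical_set_scope.
Local Open Scope ring_scope.

(* The library norm on ['rV[R]_n] is the sup norm, so Euclidean balls and
   spheres are written out with the sum of squares. *)
Definition sqnorm (R : realType) (n : nat) (x : 'rV[R]_n) : R :=
  \sum_(i < n) x ord0 i ^+ 2.

Section ProjectiveSpace.
Variables (R : realType) (p : nat).

Definition sphere : set 'rV[R]_p.+1 := [set x | sqnorm x = 1].

Definition antipodal (x y : sphere) : bool :=
  (\val x == \val y) || (\val x == - \val y).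

Lemma antipodal_refl : reflexive antipodal.
Proof. by move=> x; rewrite /antipodal eqxx. Qed.

Lemma antipodal_sym : symmetric antipodal.
Proof.
by move=> x y; rewrite /antipodal [\val x == \val y]eq_sym [_ == - _]eq_sym eqr_oppLR.
Qed.

Lemma antipodal_trans : transitive antipodal.
Proof.
move=> y x z; rewrite /antipodal => /orP[] /eqP-> //.
by rewrite eqr_opp eqr_oppLR orbC.
Qed.

Canonical antipodal_equiv : equiv_rel sphere :=
  EquivRel antipodal antipodal_refl antipodal_sym antipodal_trans.

Definition RP : topologicalType :=
  quotient_topology {eq_quot antipodal_equiv}%qT.

(* The class [L] is the line spanned by either of its two unit vectors, one of
   which is [repr L]. *)
Definition on_line (L : RP) (v : 'rV[R]_p.+1) : Prop :=
  (v <= \val (repr L : sphere))%MS.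

(* The total space of [r xi_p], as a subspace of [RP^p * (R^(p+1))^r]: a point
   is a line [L] with [r] vectors of [L], stored as the rows of a matrix. *)
Definition whitney_xi (r : nat) : set (RP * 'M[R]_(r, p.+1)) :=
  [set LV | forall k : 'I_r, on_line LV.1 (row k LV.2)].
Arguments whitney_xi : clear implicits.

Definition is_section (r : nat) (s : RP -> whitney_xi r) : Prop :=
  continuous s /\ forall L, (\val (s L)).1 = L.

Definition lin_indep_sections (r k : nat) (s : 'I_k -> RP -> whitney_xi r) : Prop :=
  forall L, free [tuple (\val (s i L)).2 | i < k].

Definition admits_sections (r k : nat) : Prop :=
  exists s : 'I_k -> RP -> whitney_xi r,
    (forall i, is_section (s i)) /\ lin_indep_sections s.

End ProjectiveSpace.

Arguments sphere R p : clear implicits.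
Arguments antipodal_equiv R p : clear implicits.
Arguments whitney_xi R p r : clear implicits.

Section Submanifolds.
Variables (R : realType) (n N : nat).
Implicit Types (D : set 'rV[R]_n) (f : 'rV[R]_n -> 'rV[R]_N).
Implicit Types (M : set 'rV[R]_N) (l : set 'rV[R]_N).

(* As usual for a domain that need not be open, [f] is C^1 on a neighbourhood
   of [D]. *)
Definition C1_on D f : Prop :=
  exists U, [/\ open U, D `<=` U &
    forall x, U x -> differentiable f x /\ {for x, continuous (jacobian f)}].

Definition C1_embedding D f : Prop :=
  [/\ C1_on D f,
      forall x, D x -> injective ('d f x) &
      exists g, {in D, cancel f g} /\ {within f @` D, continuous g}].

Definition half_space (a : R) : set 'rV[R]_n :=
  [set x | forall i : 'I_n, i = 0%N :> nat -> a <= x ord0 i].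

(* Manifolds may have a boundary. Taking [a] below all first coordinates in
   [O] gives the charts at interior points. *)
Definition local_param M D f : Prop :=
  [/\ exists (a : R) (O : set 'rV[R]_n), open O /\ D = O `&` half_space a,
      C1_embedding D f &
      exists2 W, open W & f @` D = M `&` W].

Definition C1_submanifold M : Prop :=
  forall p, M p -> exists D f, local_param M D f /\ (f @` D) p.

Definition tangent_vector M (p v : 'rV[R]_N) : Prop :=
  exists D f x w, [/\ local_param M D f, D x, f x = p & 'd f x w = v].

Definition line (p v : 'rV[R]_N) : set 'rV[R]_N := range (fun t : R => p + t *: v).

Definition tangent_line M (p : 'rV[R]_N) l : Prop :=
  exists v, [/\ v != 0, tangent_vector M p v & l = line p v].

Definition parallel l l' : Prop :=
  exists p q v, [/\ v != 0, l = line p v & l' = line q v].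

Definition skew l l' : Prop := ~ parallel l l' /\ l `&` l' = set0.

Definition totally_skew M : Prop :=
  C1_submanifold M /\
  forall p q l l', p != q -> tangent_line M p l -> tangent_line M q l' -> skew l l'.

Definition totally_skew_disk M : Prop :=
  totally_skew M /\
  exists2 f, C1_embedding [set x | sqnorm x <= 1] f &
             M = f @` [set x | sqnorm x <= 1].

Definition totally_skew_embedding f : Prop :=
  C1_embedding setT f /\ totally_skew (range f).

End Submanifolds.

Arguments totally_skew_disk {R} n {N} M.

Definition is_smallest (P : nat -> Prop) (m : nat) : Prop :=
  P m /\ forall k, P k -> (m <= k)%N.

Definition is_N (R : realType) (n N : nat) : Prop :=
  is_smallest (fun N => exists f : 'rV[R]_n -> 'rV[R]_N, totally_skew_embedding f) N.

Definition is_r (R : realType) (n r : nat) : Prop :=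
  is_smallest (fun r => admits_sections R n.-1 r n.+1) r.

(* Main.v *)
Require Import Defs.
From mathcomp Require Import all_boot all_order all_algebra.
From mathcomp Require Import all_classical all_reals all_analysis.
From mathcomp Require Import lra.

Set Implicit Arguments.
Unset Strict Implicit.
Unset Printing Implicit Defensive.

Import Order.TTheory GRing.Theory Num.Theory.
Import numFieldNormedType.Exports.

Local Open Scope classical_set_scope.
Local Open Scope ring_scope.

(* For a totally skew [f], the rows of [J f y] and [J f (-y)] and the vector
   [f y - f (-y)] are linearly independent: a relation with nonzero last coefficient
   makes two tangent lines meet, any other one makes them parallel. The rows of
   [J f y + J f (-y)] are even in [y], those of [J f y - J f (-y)] and the difference
   [f y - f (-y)] are odd. For small [y] the [n] even vectors stay close to [2 J f 0],
   so [R^N] modulo their span is identified with a fixed [R^(N-n)] by a map that is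
   even in [y], and the [n+1] odd vectors become independent odd maps from the sphere to
   [R^(N-n)]. An odd map [a] gives the section [[x] |-> (a_k(x) x)_k] of [(N-n) xi]. *)

(** * Limits of matrix-valued functions *)

Section MatrixLimits.
Variables (R : realType) (T : Type) (F : set_system T).
Context {FF : Filter F}.

Lemma cvg_mx m n (A : T -> 'M[R]_(m, n)) (L : 'M[R]_(m, n)) :
  (forall i j, A x i j @[x --> F] --> L i j) -> A x @[x --> F] --> L.
Proof.
move=> AL U [P PL PU]; suff: \forall x \near F, forall i j, P i j (A x i j).
  by move=> H; apply: (@filterS _ F _ _ _ _ H) => x Px; apply: PU.
by apply: filter_forall => i; apply: filter_forall => j; apply: AL; apply: PL.
Qed.

Lemma cvg_coord m n (A : T -> 'M[R]_(m, n)) (L : 'M[R]_(m, n)) i j :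
  A x @[x --> F] --> L -> A x i j @[x --> F] --> L i j.
Proof.
move=> AL; apply: (@cvg_comp _ _ _ A (fun M : 'M[R]_(m, n) => M i j) _ _ _ AL).
exact: coord_continuous.
Qed.

Lemma cvg_big_ord_sum n (f : 'I_n -> T -> R) (l : 'I_n -> R) :
  (forall i, f i x @[x --> F] --> l i) ->
  \sum_(i < n) f i x @[x --> F] --> \sum_(i < n) l i.
Proof.
elim: n f l => [|n IH] f l fl.
  by under eq_fun do rewrite big_ord0; rewrite big_ord0; apply: cvg_cst.
under eq_fun do rewrite big_ord_recl.
rewrite big_ord_recl; apply: cvgD; first exact: fl.
exact: IH.
Qed.

Lemma cvg_mulmx m n p (A : T -> 'M[R]_(m, n)) (B : T -> 'M[R]_(n, p))
    (L : 'M[R]_(m, n)) (M : 'M[R]_(n, p)) :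
  A x @[x --> F] --> L -> B x @[x --> F] --> M ->
  A x *m B x @[x --> F] --> L *m M.
Proof.
move=> AL BM; apply: cvg_mx => i j; under eq_fun do rewrite mxE; rewrite mxE.
by apply: cvg_big_ord_sum => k; apply: cvgM; apply: cvg_coord.
Qed.

Lemma cvg_det n (A : T -> 'M[R]_n) (L : 'M[R]_n) :
  A x @[x --> F] --> L -> \det (A x) @[x --> F] --> \det L.
Proof.
elim: n A L => [|n IH] A L AL.
  by under eq_fun do rewrite det_mx00; rewrite det_mx00; apply: cvg_cst.
under eq_fun do rewrite (expand_det_row _ ord0).
rewrite (expand_det_row _ ord0); apply: cvg_big_ord_sum => j.
apply: cvgM; first exact: cvg_coord.
rewrite /cofactor; apply: cvgM; first exact: cvg_cst.
apply: IH; apply: cvg_mx => a b; under eq_fun do rewrite !mxE.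
by rewrite !mxE; apply: cvg_coord.
Qed.

(** The adjugate serves as a division-free inverse; its entries are signed minors, to which
    [cvg_det] applies. *)
Lemma cvg_adj n (A : T -> 'M[R]_n) (L : 'M[R]_n) :
  A x @[x --> F] --> L -> \adj (A x) @[x --> F] --> \adj L.
Proof.
move=> AL; apply: cvg_mx => i j; under eq_fun do rewrite mxE; rewrite mxE.
rewrite /cofactor; apply: cvgM; first exact: cvg_cst.
apply: cvg_det; apply: cvg_mx => a b; under eq_fun do rewrite !mxE.
by rewrite !mxE; apply: cvg_coord.
Qed.

Lemma cvg_trmx m n (A : T -> 'M[R]_(m, n)) (L : 'M[R]_(m, n)) :
  A x @[x --> F] --> L -> (A x)^T @[x --> F] --> L^T.
Proof.
move=> AL; apply: cvg_mx => i j; under eq_fun do rewrite mxE; rewrite mxE.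
exact: cvg_coord.
Qed.

Lemma cvg_row m n i (A : T -> 'M[R]_(m, n)) (L : 'M[R]_(m, n)) :
  A x @[x --> F] --> L -> row i (A x) @[x --> F] --> row i L.
Proof.
move=> AL; apply: cvg_mx => a b; under eq_fun do rewrite mxE; rewrite mxE.
exact: cvg_coord.
Qed.

Lemma cvg_col_mx m1 m2 n (A : T -> 'M[R]_(m1, n)) (B : T -> 'M[R]_(m2, n))
    (L : 'M[R]_(m1, n)) (M : 'M[R]_(m2, n)) :
  A x @[x --> F] --> L -> B x @[x --> F] --> M ->
  col_mx (A x) (B x) @[x --> F] --> col_mx L M.
Proof.
move=> AL BM; apply: cvg_mx => i j; under eq_fun do rewrite mxE; rewrite mxE.
by case: splitP => k _; apply: cvg_coord.
Qed.

End MatrixLimits.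

(** * The Euclidean square norm and the sphere *)

Section SumOfSquares.
Variables (R : realType) (n : nat).
Implicit Types x : 'rV[R]_n.

Lemma sqnorm0 : sqnorm (0 : 'rV[R]_n) = 0.
Proof. by rewrite /sqnorm big1 // => i _; rewrite mxE expr0n. Qed.

Lemma sqnorm_coord_le x i : x ord0 i ^+ 2 <= sqnorm x.
Proof. by rewrite /sqnorm (bigD1 i) //= lerDl sumr_ge0 // => j _; apply: sqr_ge0. Qed.

Lemma sqnormZ c x : sqnorm (c *: x) = c ^+ 2 * sqnorm x.
Proof. by rewrite /sqnorm mulr_sumr; apply: eq_bigr => i _; rewrite mxE exprMn. Qed.

Lemma sqnormN x : sqnorm (- x) = sqnorm x.
Proof. by rewrite -scaleN1r sqnormZ sqrrN expr1n mul1r. Qed.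

End SumOfSquares.

Lemma sphere_neq0 (R : realType) p (x : 'rV[R]_p.+1) : sphere R p x -> x != 0.
Proof.
move=> Sx; apply: contraPneq Sx => ->; rewrite /sphere /= sqnorm0 => /esym/eqP.
by rewrite oner_eq0.
Qed.

(** * Sections over projective space from odd maps on the sphere *)

Section OddMaps.
Variables (R : realType) (p r : nat).

Local Notation QRP := (quotient_topology {eq_quot (antipodal_equiv R p)}%qT).

(** [repr] may return [x] or [- x]; both span the same line. *)
Lemma sphere_on_line (x : sphere R p) :
  on_line (\pi_QRP%qT x) (\val x).
Proof.
rewrite /on_line; case: piP => y /eqquotP.
rewrite /= /antipodal => /orP[] /eqP->; first exact: submx_refl.
by rewrite eqmx_opp submx_refl.
Qed.

(** The tensor of [a] and [x]: it is unchanged when both change sign, so an odd [a] makes it a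
    function of the line alone. *)
Definition line_tensor (a : 'rV[R]_r) (x : sphere R p) : whitney_xi R p r.
Proof.
exists (\pi_QRP%qT x, a^T *m \val x); apply/mem_set => k /=.
by rewrite row_mul; apply: submx_trans (submxMl _ _) (sphere_on_line x).
Defined.

Lemma admits_sections_of_odd k (g : 'rV[R]_p.+1 -> 'M[R]_(k, r)) :
  (forall x, sphere R p x -> {for x, continuous g}) ->
  (forall x, sphere R p x -> g (- x) = - g x) ->
  (forall x, sphere R p x -> row_free (g x)) ->
  admits_sections R p r k.
Proof.
move=> gc godd gfree.
have sphereP (x : sphere R p) : sphere R p (\val x) by case: x => x /= /set_mem.
exists (fun i => (fun x => line_tensor (row i (g (\val x))) x) \o repr).
split=> [i|L].
  split=> [|L]; last by rewrite /= reprK.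
  (* [repr] need not be continuous, so continuity is checked on the sphere, together with equality
     of the values at antipodal points. *)
  apply: repr_comp_continuous => [|x y /eqP/eqquotP /= xy]; last first.
    apply/eqP/val_inj; congr pair; first exact/eqquotP.
    case: x y xy => x Sx [y Sy] xy; have {xy} : (x == y) || (x == - y) := xy.
    move=> /orP[] /eqP xy /=; rewrite {}xy //.
    by rewrite godd ?linearN /= ?linearN /= ?mulmxN ?mulNmx ?opprK //; apply/set_mem.
  apply: continuous_comp_initial => x.
  have valc : {for x, continuous (\val : sphere R p -> 'rV[R]_p.+1)}.
    exact: initial_continuous.
  have tensorc : (row i (g (\val y)))^T *m \val y @[y --> x] -->
                 (row i (g (\val x)))^T *m \val x.
    apply: (@cvg_mulmx _ _ (nbhs x)); last exact: valc.
    apply: (@cvg_trmx _ _ (nbhs x)); apply: (@cvg_row _ _ (nbhs x)).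
    by apply: (@continuous_comp _ _ _ _ g) => //; apply: gc.
  have pic := @pi_continuous _ {eq_quot (antipodal_equiv R p)}%qT x.
  exact: (cvg_pair pic tensorc).
apply/freeP => c c0 i.
have := sphereP (repr L); set x := \val _ => Sx.
(* A relation among the sections at [L] says that the tensor of a combination of the rows of [g x]
   with [x] vanishes; a nonzero coordinate of [x] then kills the combination. *)
have gx0 : (\row_j c j *m g x)^T *m x = 0.
  rewrite -[RHS]c0 mulmx_sum_row linear_sum mulmx_suml; apply: eq_bigr => j _.
  by rewrite (nth_map j) ?size_enum_ord // nth_ord_enum mxE linearZ -scalemxAl.
have x0 := sphere_neq0 Sx.
have [j xj] : exists j, x ord0 j != 0.
  by apply/existsP; apply: contraNT x0 => /existsPn xj; apply/eqP/rowP => j;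
    rewrite mxE; apply/eqP/negPn/xj.
have /rowP/(_ i) : \row_j c j = 0 :> 'rV_k.
  apply: (row_free_inj (gfree _ Sx)); rewrite mul0mx; apply/rowP => l.
  move/matrixP: gx0 => /(_ l j); rewrite mxE big_ord1 mxE !mxE => /eqP.
  by rewrite mulf_eq0 (negPf xj) orbF => /eqP.
by rewrite !mxE.
Qed.

End OddMaps.

(** * Tangent lines of a totally skew image *)

Section TotallySkew.
Variables (R : realType) (n N : nat).
Implicit Types (D E O : set 'rV[R]_n) (f : 'rV[R]_n -> 'rV[R]_N).

(** The inverse [g] is continuous on the image of [E], so the preimage of [O] under [g] is
    relatively open there; being the image of [O], it provides the open set of the chart. *)
Lemma local_param_restrict E O f a :
  C1_embedding E f -> open O -> O `<=` E -> O `<=` half_space a ->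
  local_param (f @` E) O f.
Proof.
move=> [[U [oU EU Uf]] dfinj [g [gK0 gc]]] oO OE Oa.
have gK x : E x -> g (f x) = x by move=> Ex; apply/gK0/mem_set.
split.
- by exists a, O; split=> //; rewrite setIidl.
- split; first by exists U; split=> //; apply: subset_trans OE EU.
    by move=> x /OE; apply: dfinj.
  exists g; split; first by move=> x /set_mem/OE; apply: gK.
  by apply: continuous_subspaceW gc; apply: image_subset.
move/continuousP: gc => /(_ O oO)/open_subspaceP[V oV VO].
exists V => //; apply/seteqP; split=> [_ [x Ox <-]|_ [[x Ex <-] Vx]].
  have Efx : (f @` E) (f x) by exists x => //; apply: OE.
  have Ogf : O (g (f x)) by rewrite gK //; apply: OE.
  split=> //; have : (g @^-1` O `&` f @` E) (f x) by [].
  by rewrite -VO => -[].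
have : (V `&` f @` E) (f x) by split=> //; exists x.
by rewrite VO => -[Ogf _]; exists x => //; rewrite -(gK x Ex).
Qed.

Lemma open_unit_ball : open [set x : 'rV[R]_n | sqnorm x < 1].
Proof.
have cs : continuous (@sqnorm R n).
  move=> x.
  apply: (@cvg_big_ord_sum R _ (nbhs x) _ n
    (fun i (y : 'rV[R]_n) => y ord0 i ^+ 2)) => i.
  apply: (@continuous_comp _ _ _ (fun y : 'rV[R]_n => y ord0 i) (fun a => a ^+ 2)).
    exact: coord_continuous.
  exact: exprn_continuous.
rewrite (_ : [set x | _] = @sqnorm R n @^-1` [set a | a < 1]) //.
by apply: open_comp (@open_lt _ _) => x _; apply: cs.
Qed.

Lemma tangent_vector_unit_ball E f x w :
  C1_embedding E f -> [set y | sqnorm y < 1] `<=` E -> sqnorm x < 1 ->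
  tangent_vector n (f @` E) (f x) (w *m jacobian f x).
Proof.
move=> fE BE x1; exists [set y | sqnorm y < 1], f, x, w.
split=> //; last by rewrite mul_rV_lin1.
(* Every coordinate of a point of the open unit ball exceeds -1. *)
apply: (local_param_restrict (a := -1)) => //; first exact: open_unit_ball.
move=> y /= y1 i _; have := le_lt_trans (sqnorm_coord_le y i) y1.
by move: (y ord0 i) => a; nra.
Qed.

End TotallySkew.

(** Working in the open unit ball covers the closed disk and the whole space at once. *)
Lemma totally_skew_independent (R : realType) (p N : nat)
    (E : set 'rV[R]_p.+1) (f : 'rV[R]_p.+1 -> 'rV[R]_N) x y (u v : 'rV[R]_p.+1) c :
  C1_embedding E f -> totally_skew p.+1 (f @` E) ->
  [set z | sqnorm z < 1] `<=` E -> sqnorm x < 1 -> sqnorm y < 1 -> x != y ->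
  u *m jacobian f x + v *m jacobian f y = c *: (f y - f x) ->
  [/\ u = 0, v = 0 & c = 0].
Proof.
move=> fE [_ fskew] BE x1 y1 xy uv.
have dfinj z (w : 'rV_p.+1) : sqnorm z < 1 -> w *m jacobian f z = 0 -> w = 0.
  move=> z1; rewrite mul_rV_lin1 => fw0; case: fE => _ /(_ z (BE _ z1)) inj _.
  by apply: inj; rewrite fw0 linear0.
have fxy : f x != f y.
  case: fE => _ _ [g [gK _]]; apply: contra_neq xy => fxy.
  by rewrite -(gK x (mem_set (BE _ x1))) -(gK y (mem_set (BE _ y1))) fxy.
have tangent z (w : 'rV_p.+1) : sqnorm z < 1 -> w != 0 ->
    tangent_line p.+1 (f @` E) (f z) (line (f z) (w *m jacobian f z)).
  move=> z1 w0; exists (w *m jacobian f z); split=> //.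
    by apply: contra_neq w0; apply: dfinj.
  exact: tangent_vector_unit_ball.
(* For [w = 0] any tangent line will do. *)
have tangent_through z (w : 'rV_p.+1) : sqnorm z < 1 ->
    exists2 l, tangent_line p.+1 (f @` E) (f z) l & l (f z + w *m jacobian f z).
  move=> z1; have [->|w0] := eqVneq w 0.
    exists (line (f z) (const_mx 1 *m jacobian f z)).
      apply: tangent => //; apply/eqP => /rowP/(_ ord0)/eqP.
      by rewrite !mxE oner_eq0.
    by exists 0; rewrite // scale0r mul0mx.
  exists (line (f z) (w *m jacobian f z)); first exact: tangent.
  by exists 1; rewrite // scale1r.
(* If [c] were nonzero, dividing the relation by [c] would give a common point of a tangent line at
   [f x] and one at [f y]. *)
have c0 : c = 0.
  apply/eqP; apply: contraT => c0.
  have [l tl lx] := tangent_through x (c^-1 *: u) x1.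
  have [l' tl' ly] := tangent_through y (- (c^-1 *: v)) y1.
  have [_ ll'] := fskew _ _ _ _ fxy tl tl'.
  suff e : f x + c^-1 *: u *m jacobian f x = f y + - (c^-1 *: v) *m jacobian f y.
    have : (l `&` l') (f x + c^-1 *: u *m jacobian f x).
      by split; [exact: lx|rewrite e; exact: ly].
    by rewrite ll' => -[].
  have -> : c^-1 *: u *m jacobian f x = f y - f x - c^-1 *: (v *m jacobian f y).
    rewrite -scalemxAl -[u *m _](addrK (v *m jacobian f y)) uv.
    by rewrite scalerBr scalerA mulVf // scale1r.
  by rewrite addrA [f x + _]addrC subrK mulNmx scalemxAl.
move: uv; rewrite c0 scale0r => /eqP; rewrite addr_eq0 => /eqP uv.
suff u0 : u = 0.
  split=> //; apply: (dfinj y) => //; apply/eqP.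
  by rewrite -oppr_eq0 -uv u0 mul0mx.
apply/eqP; apply: contraT => u0.
have v0 : v != 0.
  apply: contra_neq u0 => v0; apply: (dfinj x) => //.
  by rewrite uv v0 mul0mx oppr0.
have [npar _] := fskew _ _ _ _ fxy (tangent x u x1 u0) (tangent y v y1 v0).
(* With [c = 0] the two directions are opposite, so [t |-> - t] reparametrises the second line with
   the direction of the first. *)
case: npar; exists (f x), (f y), (u *m jacobian f x); split; last 1 first.
- by rewrite uv; apply/seteqP; split=> _ [t _ <-]; exists (- t) => //;
    rewrite ?scalerN ?scaleNr ?opprK.
- by apply: contra_neq u0; apply: dfinj.
- by [].
Qed.

(** * Linear algebra: complements and projections *)

Lemma row_free_complement (F : fieldType) n m (A : 'M[F]_(n, n + m)) :
  row_free A -> exists (B : 'M[F]_(n + m, n)) (C : 'M[F]_(n + m, m)),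
    A *m B \in unitmx /\
    forall v : 'rV_(n + m), v *m B = 0 -> v *m C = 0 -> v = 0.
Proof.
move=> /eqP rA; set U := row_ebase A.
(* The rows of [U] form a basis whose first [n] members span the rows of [A]. [B] reads the first
   [n] coordinates in this basis, [C] the other [m]. *)
exists (lsubmx (invmx U)), (rsubmx (invmx U)).
have UV : U \in unitmx := row_ebase_unit A.
split=> [|v vB vC].
  suff -> : A *m lsubmx (invmx U) = col_ebase A by apply: col_ebase_unit.
  have : A *m invmx U = col_ebase A *m pid_mx n.
    by rewrite -{1}(mulmx_ebase A) mulmxK // rA.
  rewrite -{1}[invmx U]hsubmxK mul_mx_row pid_mx_row mul_mx_row mulmx1.
  by case/eq_row_mx.
by rewrite -[v](mulmxKV UV) -[invmx U]hsubmxK mul_mx_row vB vC row_mx0 mul0mx.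
Qed.

(* [v |-> v - v B (A B)^-1 A] kills the rows of [A]; scaling it by the determinant makes
   it polynomial in [A], hence visibly continuous. *)
Lemma row_free_projection (F : fieldType) k n m N (A : 'M[F]_(n, N))
    (O : 'M[F]_(k, N)) (B : 'M[F]_(N, n)) (C : 'M[F]_(N, m)) :
  \det (A *m B) != 0 ->
  (forall v : 'rV_N, v *m B = 0 -> v *m C = 0 -> v = 0) ->
  (forall (w : 'rV_k) (z : 'rV_n), w *m O = z *m A -> w = 0) ->
  row_free ((\det (A *m B) *: O - O *m B *m \adj (A *m B) *m A) *m C).
Proof.
move=> d0 BC OA; apply: inj_row_free => w; rewrite mulmxA => wC.
set d := \det _ in d0 wC *.
have wB : w *m (d *: O - O *m B *m \adj (A *m B) *m A) *m B = 0.
  rewrite mulmxBr mulmxBl -scalemxAr -scalemxAl -!mulmxA mul_adj_mx.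
  by rewrite !mul_mx_scalar -!scalemxAr subrr.
(* The projected vector is killed by both [B] and [C], hence is zero, so [w *m O] is a combination
   of the rows of [A]. *)
have /eqP := BC _ wB wC; rewrite mulmxBr subr_eq0 -scalemxAr !mulmxA => /eqP dwO.
apply: (OA w (d^-1 *: (w *m O *m B *m \adj (A *m B)))).
by rewrite -scalemxAl -dwO scalerA mulVf // scale1r.
Qed.

(** * Even and odd frames at antipodal points *)

Section DifferenceFrames.
Variables (R : realType) (n N : nat) (f : 'rV[R]_n -> 'rV[R]_N).

Definition even_frame (y : 'rV[R]_n) : 'M[R]_(n, N) :=
  jacobian f y + jacobian f (- y).

Definition odd_frame (y : 'rV[R]_n) : 'M[R]_(1 + n, N) :=
  col_mx (f y - f (- y)) (jacobian f y - jacobian f (- y)).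

Lemma even_frameN y : even_frame (- y) = even_frame y.
Proof. by rewrite /even_frame (opprK y); apply: addrC. Qed.

Lemma odd_frameN y : odd_frame (- y) = - odd_frame y.
Proof.
by rewrite /odd_frame (opprK y) opp_col_mx (opprB (f y)) (opprB (jacobian f y)).
Qed.

Lemma continuous_atN (T : topologicalType) (g : 'rV[R]_n -> T) (y : 'rV[R]_n) :
  {for - y, continuous g} -> g (- z) @[z --> y] --> g (- y).
Proof.
have Ny : (- z) @[z --> y] --> - y by apply: oppr_continuous.
by move=> gNy; apply: (@cvg_comp _ _ _ -%R g _ _ _ Ny gNy).
Qed.

Lemma cvg_even_frame (y : 'rV[R]_n) :
  {for y, continuous (jacobian f)} -> {for - y, continuous (jacobian f)} ->
  even_frame z @[z --> y] --> even_frame y.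
Proof.
move=> Jy JNy.
exact: (@cvgD _ _ _ (nbhs y) _ _ _ _ _ Jy (continuous_atN JNy)).
Qed.

Lemma cvg_odd_frame (y : 'rV[R]_n) :
  {for y, continuous f} -> {for - y, continuous f} ->
  {for y, continuous (jacobian f)} -> {for - y, continuous (jacobian f)} ->
  odd_frame z @[z --> y] --> odd_frame y.
Proof.
move=> fy fNy Jy JNy; apply: (@cvg_col_mx R _ (nbhs y)).
  exact: (@cvgB _ _ _ (nbhs y) _ _ _ _ _ fy (continuous_atN fNy)).
exact: (@cvgB _ _ _ (nbhs y) _ _ _ _ _ Jy (continuous_atN JNy)).
Qed.

End DifferenceFrames.

(** * Sections from a totally skew embedding *)

Lemma totally_skew_admits_sections (R : realType) (p N : nat)
    (E : set 'rV[R]_p.+1) (f : 'rV[R]_p.+1 -> 'rV[R]_N) :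
  C1_embedding E f -> totally_skew p.+1 (f @` E) ->
  [set x | sqnorm x < 1] `<=` E ->
  (p.+1 <= N)%N /\ admits_sections R p (N - p.+1) p.+2.
Proof.
move=> fE fskew BE.
have q0 : sqnorm (0 : 'rV[R]_p.+1) < 1.
  by rewrite sqnorm0 ltr01.
have J0 : row_free (jacobian f 0).
  apply: inj_row_free => w; rewrite mul_rV_lin1 => fw0.
  case: fE => _ /(_ 0 (BE _ q0)) inj _.
  by apply: inj; rewrite fw0 linear0.
have pN : (p.+1 <= N)%N by move: (rank_leq_col (jacobian f 0)); rewrite (eqP J0).
(* As [p.+1 <= N], the natural-number subtraction is exact and [N] can be written [p.+1 + m]. *)
split=> //; move: f fE fskew J0; rewrite -(subnKC pN); move: (N - p.+1)%N => m.
rewrite addKn => f fE fskew J0 {N pN}.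
(* [B] and [C] depend on [jacobian f 0] only: they are the fixed coordinates used for all small
   [y]. *)
have [B [C [J0B BC]]] := row_free_complement J0.
have [fc Jc] : (forall y, sqnorm y < 1 -> {for y, continuous f}) /\
    (forall y, sqnorm y < 1 -> {for y, continuous (jacobian f)}).
  case: fE => -[U [_ EU Uf]] _ _; split=> y /BE/EU/Uf[] // df _.
  exact: differentiable_continuous.
pose d y := \det (even_frame f y *m B).
have dc y : sqnorm y < 1 -> d z @[z --> y] --> d y.
  move=> y1; apply: (@cvg_det R _ (nbhs y)).
  apply: (@cvg_mulmx R _ (nbhs y)); last exact: cvg_cst.
  by apply: cvg_even_frame; apply: Jc; rewrite ?sqnormN.
(* The even frame at 0 is twice [jacobian f 0]. *)
have d0 : d 0 != 0.
  rewrite /d /even_frame oppr0 -mulr2n -scaler_nat -scalemxAl detZ.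
  by rewrite mulf_neq0 ?expf_neq0 ?pnatr_eq0 // -unitfE -unitmxE.
have /nbhs_ballP[e /= e0 de] : \forall y \near (0 : 'rV[R]_p.+1), d y != 0.
  exact: cvgr_neq0 (dc _ q0) d0.
(* [t < 1] keeps [t *: x] in the unit ball. [t < e] keeps it in the sup-norm ball where [d] is
   nonzero, since a unit vector has coordinates of absolute value at most 1. *)
pose t := Num.min e 1 / 2.
have t0 : 0 < t by rewrite divr_gt0 // lt_min e0 ltr01.
have te : t < e by rewrite ltr_pdivrMr // gt_min ltr_pMr // ltr1n.
have t1 : t < 1 by rewrite ltr_pdivrMr // gt_min mul1r ltr1n orbT.
have tx1 (x : 'rV[R]_p.+1) : sphere R p x -> sqnorm (t *: x) < 1.
  by move=> Sx; rewrite sqnormZ Sx mulr1 expr_lt1 // ltW.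
have tx0 (x : 'rV[R]_p.+1) : sphere R p x -> d (t *: x) != 0.
  move=> Sx; apply: de; split=> // i j; rewrite ord1 !mxE /ball /= sub0r normrN.
  rewrite normrM gtr0_norm //; apply: le_lt_trans te.
  have xj1 : `|x 0 j| ^+ 2 <= 1.
    by rewrite -normrX ger0_norm ?sqr_ge0 // -Sx sqnorm_coord_le.
  by rewrite ler_piMr ?(ltW t0) // -(@expr_le1 _ 2).
(* The projection of [row_free_projection]: odd in [y], because [d] and the even frame are even and
   the odd frame enters linearly. *)
pose h y := (d y *: odd_frame f y
  - odd_frame f y *m B *m \adj (even_frame f y *m B) *m even_frame f y) *m C.
apply: (@admits_sections_of_odd R p m p.+2 (h \o *:%R t)) => x Sx.
- have y1 := tx1 x Sx; set y := t *: x in y1.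
  have yN1 : sqnorm (- y) < 1 by rewrite sqnormN.
  apply: continuous_comp; first exact: scaler_continuous.
  have ec : even_frame f z @[z --> y] --> even_frame f y.
    by apply: cvg_even_frame; apply: Jc.
  have oc : odd_frame f z @[z --> y] --> odd_frame f y.
    apply: cvg_odd_frame; [exact: fc|exact: fc|exact: Jc|exact: Jc].
  apply: (@cvg_mulmx R _ (nbhs y)); last exact: cvg_cst.
  apply: (@cvgB _ _ _ (nbhs y)); first by apply: cvgZ => //; apply: dc.
  apply: (@cvg_mulmx R _ (nbhs y)) => //.
  apply: (@cvg_mulmx R _ (nbhs y)); first exact: cvg_mulmx oc (cvg_cst B).
  by apply: (@cvg_adj R _ (nbhs y)); exact: cvg_mulmx ec (cvg_cst B).
- by rewrite /h /d /= scalerN even_frameN odd_frameN scalerN !mulNmx -opprD mulNmx.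
apply: (@row_free_projection R (1 + p.+1)); [exact: tx0|exact: BC|].
move=> w z; set y := t *: x.
have yN : y != - y.
  rewrite -subr_eq0 opprK -mulr2n -scaler_nat scalerA scaler_eq0 negb_or.
  by rewrite mulf_neq0 ?pnatr_eq0 ?gt_eqF //= (sphere_neq0 Sx).
rewrite -[w]hsubmxK /odd_frame /even_frame mul_row_col.
set c := lsubmx w; set s := rsubmx w.
rewrite [c]mx11_scalar mul_scalar_mx mulmxBr mulmxDr => wz.
(* Writing [w] as [(c, s)] and collecting the terms at [y] and at [- y] gives these coefficients. *)
have [] := @totally_skew_independent R p _ E f y (- y) (s - z) (- s - z) (c 0 0)
   fE fskew BE (tx1 x Sx) _ yN.
- by rewrite sqnormN tx1.
- rewrite !mulmxBl mulNmx -[f (- y) - f y]opprB scalerN.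
  have regroup (V : zmodType) (a b a' b' v : V) :
      v + (a - b) = a' + b' -> a - a' + (- b - b') = - v.
    by move=> /(canRL (addrK _)) ->; rewrite opprB opprD addrACA.
  exact: regroup wz.
(* From [s - z = 0] and [- s - z = 0] follows [2 s = 0]. *)
move=> /eqP; rewrite subr_eq0 => /eqP <- /eqP.
rewrite -opprD oppr_eq0 -mulr2n -scaler_nat scaler_eq0 pnatr_eq0 /= => /eqP -> ->.
by rewrite raddf0 row_mx0.
Qed.

Theorem theorem1p4 (R : realType) (n : nat) :
  (1 <= n)%N ->
  (forall N : nat,
     (exists M : set 'rV[R]_N, totally_skew_disk n M) ->
     admits_sections R n.-1 (N - n)%N n.+1) /\
  (forall N : nat, is_N R n N ->
     exists r : nat, is_r R n r /\ (r + n <= N)%N).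
Proof.
(* The closed unit ball and the whole space both contain the open unit ball, so the same
   construction applies to each. *)
case: n => // p _; split=> [N [M [Mskew [f fD Mf]]]|N [[f [fT fskew]] _]].
  have [] // := @totally_skew_admits_sections R p N _ f fD.
    by rewrite -Mf.
  by move=> x /ltW.
have [//|pN secs] := totally_skew_admits_sections fT fskew.
(* The value [N - p.+1] shows that the set minimised by [r(n)] is nonempty. *)
have ex : exists r, `[< admits_sections R p r p.+2 >].
  by exists (N - p.+1)%N; apply/asboolP.
have [r /asboolP rsecs rmin] := ex_minnP ex.
exists r; split; first by split=> // k ksecs; apply/rmin/asboolP.
(* [pN] excludes truncation, so [r <= N - p.+1] yields the bound on the sum. *)
by rewrite addnC -leq_subRL //; apply/rmin/asboolP.
Qed.
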